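(* The space $\mathcal{B}_{aa}$ of smooth almost automorphic functions has the following properties: 1. $\mathcal{B}_{aa}=\mathcal{C}_{aa}\cap\mathcal{D}_{L^\infty}$. 2. $\mathcal{B}_{aa}$ is a Fréchet subalgebra of $\mathcal{D}_{L^\infty}$. 3. $\mathcal{B}_{aa}\ast L^1\subset\mathcal{B}_{aa}$, i.e. $f\ast h\in\mathcal{B}_{aa}$ for all $f\in\mathcal{B}_{aa}$ and $h\in L^1$.
   Context: All functions are complex-valued and defined on $\mathbb{R}$. A continuous function $f:\mathbb{R}\to\mathbb{C}$ is almost automorphic if for every real sequence $(s_m)_{m\in\mathbb{N}}$ there is a subsequence $(s_{m_k})_k$ such that $g(x):=\lim_{k\to+\infty}f(x+s_{m_k})$ is well-defined for every $x\in\mathbb{R}$ and $\lim_{k\to+\infty}g(x-s_{m_k})=f(x)$ for every $x\in\mathbb{R}$. $\mathcal{C}_{aa}$ denotes the space of almost automorphic functions. $\mathcal{D}_{L^\infty}=\{\varphi\in\mathcal{C}^\infty:\ \varphi^{(i)}\in L^\infty\ \forall i\in\mathbb{Z}_+\}$, with the topology defined by the norms $|\varphi|_{m,\infty}=\sum_{i=0}^m\|\varphi^{(i)}\|_{L^\infty}$, $m\in\mathbb{Z}_+$; it is a Fréchet algebra under pointwise multiplication. The space of smooth almost automorphic functions is $\mathcal{B}_{aa}=\{\varphi\in\mathcal{C}^\infty:\ \varphi^{(i)}\in\mathcal{C}_{aa}\ \forall i\in\mathbb{Z}_+\}$, endowed with the topology induced by $\mathcal{D}_{L^\infty}$. *)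

(* Defs.v *)
From HB Require Import structures.
From mathcomp Require Import all_boot all_order all_algebra.
From mathcomp Require Import all_classical all_reals all_analysis.
From mathcomp Require Import complex.

Set Implicit Arguments.
Unset Strict Implicit.
Unset Printing Implicit Defensive.

Import Order.TTheory GRing.Theory Num.Theory.
Import numFieldNormedType.Exports.

Local Open Scope classical_set_scope.
Local Open Scope ring_scope.

(* [Rcomplex R] is the copy of the complex field [R[i]] carrying an [R]-algebra
   structure and the [R]-valued modulus [`|z|].  The
   instances below give it the topology of the modulus, so that continuity,
   limits and derivatives of functions [R -> Rcomplex R] are the library's. *)
Section Rcomplex_normedModType.
Variable R : realType.

Lemma Rcomplex_normrZ (l : R) (z : Rcomplex R) : `|l *: z| = `|l| * `|z|.
Proof.
case: z => a b; rewrite /Num.norm /= /Normc.normc /=.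
by rewrite !exprMn -mulrDr sqrtrM ?sqr_ge0// sqrtr_sqr.
Qed.

HB.instance Definition _ :=
  PseudoMetric.copy (Rcomplex R) (pseudoMetric_normed (Rcomplex R)).
HB.instance Definition _ := isPointed.Build (Rcomplex R) 0.
HB.instance Definition _ :=
  NormedZmod_PseudoMetric_eq.Build R (Rcomplex R) erefl.
HB.instance Definition _ :=
  PseudoMetricNormedZmod_Lmodule_isNormedModule.Build R (Rcomplex R)
    Rcomplex_normrZ.

End Rcomplex_normedModType.

Section FunctionSpaces.
Variable R : realType.
Local Notation C := (Rcomplex R).
Local Notation mu := (@lebesgue_measure R).

Implicit Types (f g h : R -> C) (A B : set (R -> C)).

Definition almost_automorphic f : Prop :=
  continuous f /\
  forall s : nat -> R, exists k : nat -> nat,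
    {homo k : m n / (m < n)%N} /\
    exists g : R -> C,
      (forall x, f (x + s (k n)) @[n --> \oo] --> g x) /\
      (forall x, g (x - s (k n)) @[n --> \oo] --> f x).

Definition Caa : set (R -> C) := [set f | almost_automorphic f].

Definition smooth f : Prop := forall i x, derivable (derive1n i f) x 1.

Definition Cmeasurable f : Prop :=
  measurable_fun setT (fun x => complex.Re (f x)) /\
  measurable_fun setT (fun x => complex.Im (f x)).

(* Extended-real-valued [L^p] norm; for [p = +oo] it is the essential supremum
   of the modulus. *)
Definition CLnorm (p : \bar R) f : \bar R :=
  Lnorm mu p (fun x => (`|f x|)%:E).

(* Borel functions, rather than almost-everywhere classes, with finite [L^p]
   norm; every class of Lebesgue measurable functions has a Borel member. *)
Definition Lp (p : \bar R) : set (R -> C) :=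
  [set f | Cmeasurable f /\ (CLnorm p f < +oo)%E].

Definition DLinf : set (R -> C) :=
  [set f | smooth f /\ forall i, Lp +oo%E (derive1n i f)].

Definition Dnorm (m : nat) f : R :=
  \sum_(i < m.+1) fine (CLnorm +oo%E (derive1n i f)).

Definition Baa : set (R -> C) :=
  [set f | smooth f /\ forall i, Caa (derive1n i f)].

(* [A] is a linear subspace of [R -> C] over the field [C] ([cst c * f] is the
   pointwise product of [f] by the complex scalar [c]), stable under pointwise
   multiplication. *)
Definition algebra_of_functions A : Prop :=
  [/\ A 0,
      forall f g, A f -> A g -> A (f + g),
      forall (c : C) f, A f -> A (cst c * f) &
      forall f g, A f -> A g -> A (f * g)].

Definition seminorm_on A (p : (R -> C) -> R) : Prop :=
  [/\ forall f, A f -> 0 <= p f,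
      forall f g, A f -> A g -> p (f + g) <= p f + p g &
      forall (c : C) f, A f -> p (cst c * f) = `|c| * p f].

(* Neighbourhoods of [f] in [A] for the topology defined by an increasing
   sequence of seminorms [p]: the balls of the [p m] form a basis.  Replacing
   [A] by [B `<=` A] gives the topology induced on [B]. *)
Definition nbhs_seminorms (p : nat -> (R -> C) -> R) A f :
    set_system (R -> C) :=
  filter_from [set me : nat * R | 0 < me.2]
    (fun me => [set g | A g /\ p me.1 (g - f) < me.2]).

(* Every Cauchy sequence of [A] converges in [A].  The topology being defined
   by countably many seminorms, this is completeness of [A]. *)
Definition seminorms_complete (p : nat -> (R -> C) -> R) A : Prop :=
  forall u : nat -> (R -> C),
    (forall n, A (u n)) ->
    (forall m (e : R), 0 < e ->
      \forall i & j \near \oo, p m (u i - u j) < e) ->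
    exists2 f, A f & u @ \oo --> nbhs_seminorms p A f.

(* [A], topologized by the sequence of seminorms [p], is a Frechet algebra:
   a complete Hausdorff locally convex space whose topology is defined by
   countably many seminorms, with a jointly continuous multiplication. *)
Record frechet_algebra (p : nat -> (R -> C) -> R) A : Prop := FrechetAlgebra {
  frechet_algebraP : algebra_of_functions A ;
  frechet_seminorm : forall m, seminorm_on A (p m) ;
  frechet_nondecreasing : forall m n f, (m <= n)%N -> A f -> p m f <= p n f ;
  frechet_hausdorff : forall f, A f -> (forall m, p m f = 0) -> f = 0 ;
  frechet_complete : seminorms_complete p A ;
  frechet_mul_continuous : forall f g, A f -> A g ->
    (fun z : (R -> C) * (R -> C) => z.1 * z.2) @
      filter_prod (nbhs_seminorms p A f) (nbhs_seminorms p A g)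
    --> nbhs_seminorms p A (f * g)
}.

Definition frechet_subalgebra (p : nat -> (R -> C) -> R) B A : Prop :=
  [/\ frechet_algebra p A, B `<=` A & frechet_algebra p B].

Definition Cintegral f : C :=
  Complex (\int[mu]_y complex.Re (f y)) (\int[mu]_y complex.Im (f y)).

Definition convolution f h : R -> C :=
  fun x => Cintegral (fun y => f (x - y) * h y).

(* The integral above is total; this says that it converges absolutely. *)
Definition convolution_defined f h : Prop :=
  forall x, Lp 1%E (fun y => f (x - y) * h y).

End FunctionSpaces.

Arguments Caa {R}.
Arguments DLinf {R}.
Arguments Dnorm {R} m f.
Arguments Baa {R}.
Arguments Lp {R} p.

(* Main.v *)
Require Import Defs.
From mathcomp Require Import all_boot all_order all_algebra.
From mathcomp Require Import all_classical all_reals all_analysis.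
From mathcomp Require Import complex lra ring measurable_realfun ess_sup_inf.

(* If [f] and its first two derivatives exist and [f''] is bounded, Taylor's
   formula makes [f'] a uniform limit of difference quotients of [f].  These
   converge along the same subsequences as [f], hence [f'] is almost automorphic
   as soon as [f] is; since almost automorphic functions are bounded, this gives
   part 1.  Taylor's remainder bound is stable under pointwise limits and under
   convolution with an integrable function, which yields the completeness of
   [DLinf] and the formula [(f * h)' = f' * h].  Uniform limits preserve almost
   automorphy by a diagonal extraction, so [Baa] is closed in [DLinf].  Finally,
   dominated convergence shows that if [f] converges to [g] along a sequence of
   translations, so does [f * h] to [g * h]. *)

Set Implicit Arguments.
Unset Strict Implicit.
Unset Printing Implicit Defensive.

Import Order.TTheory GRing.Theory Num.Theory.
Import numFieldNormedType.Exports.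

Local Open Scope classical_set_scope.
Local Open Scope ring_scope.

(** * Complex-valued calculus on the real line: parts, derivatives, Taylor's formula *)

Section ComplexValued.
Variable R : realType.
Local Notation C := (Rcomplex R).
Local Notation Re := (@complex.Re R).
Local Notation Im := (@complex.Im R).
Implicit Types (x : R) (z w : C) (f g : R -> C).

Lemma Rcomplex_normE z : `|z| = Num.sqrt (Re z ^+ 2 + Im z ^+ 2).
Proof. by case: z. Qed.

Lemma Rcomplex_normrM z w : `|z * w : C| = `|z| * `|w|.
Proof. exact: Normc.normcM. Qed.

Lemma Rcomplex_norm1 : `|1 : C| = 1.
Proof. exact: Normc.normc1. Qed.

Lemma norm_Re_le z : `|Re z| <= `|z|.
Proof. by rewrite Rcomplex_normE -sqrtr_sqr ler_wsqrtr// lerDl sqr_ge0. Qed.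

Lemma norm_Im_le z : `|Im z| <= `|z|.
Proof. by rewrite Rcomplex_normE -sqrtr_sqr ler_wsqrtr// lerDr sqr_ge0. Qed.

Lemma norm_le_ReIm z : `|z| <= `|Re z| + `|Im z|.
Proof.
rewrite Rcomplex_normE -(ger0_norm (addr_ge0 (normr_ge0 _) (normr_ge0 _))).
rewrite -sqrtr_sqr ler_wsqrtr// sqrrD !real_normK ?num_real//.
by rewrite addrAC lerDl mulrn_wge0// mulr_ge0.
Qed.

Lemma complexReD z w : Re (z + w) = Re z + Re w.
Proof. by case: z; case: w. Qed.
Lemma complexImD z w : Im (z + w) = Im z + Im w.
Proof. by case: z; case: w. Qed.
Lemma complexReN z : Re (- z) = - Re z. Proof. by case: z. Qed.
Lemma complexImN z : Im (- z) = - Im z. Proof. by case: z. Qed.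
Lemma complexReB z w : Re (z - w) = Re z - Re w.
Proof. by rewrite complexReD complexReN. Qed.
Lemma complexImB z w : Im (z - w) = Im z - Im w.
Proof. by rewrite complexImD complexImN. Qed.
Lemma complexReZ (a : R) z : Re (a *: z) = a * Re z. Proof. by case: z. Qed.
Lemma complexImZ (a : R) z : Im (a *: z) = a * Im z. Proof. by case: z. Qed.
Lemma complexReM z w : Re (z * w) = Re z * Re w - Im z * Im w.
Proof. by case: z; case: w. Qed.
Lemma complexImM z w : Im (z * w) = Re z * Im w + Im z * Re w.
Proof. by case: z; case: w. Qed.

Lemma Rcomplex_ext z w : Re z = Re w -> Im z = Im w -> z = w.
Proof. by case: z => a b; case: w => c d /= -> ->. Qed.

(** The modulus dominates the absolute value of each part and is at most their sum. Limits in [C]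
    thus reduce to real limits. *)
Lemma cvgCP T (F : set_system T) {FF : Filter F} (f : T -> C) z :
  f x @[x --> F] --> z <->
  (Re (f x) @[x --> F] --> Re z) /\ (Im (f x) @[x --> F] --> Im z).
Proof.
split => [/cvgrPdist_le fz|[/cvgrPdist_lt fr /cvgrPdist_lt fi]].
  split; apply/cvgrPdist_le => e e0; have := fz _ e0; apply: filterS => x.
    by rewrite -complexReB; apply: le_trans (norm_Re_le _).
  by rewrite -complexImB; apply: le_trans (norm_Im_le _).
apply/cvgrPdist_lt => e e0; have e2 : 0 < e / 2 by rewrite divr_gt0.
have := fr _ e2; have := fi _ e2; apply: filterS2 => x.
rewrite -complexReB -complexImB => h1 h2.
by apply: le_lt_trans (norm_le_ReIm _) _; lra.
Qed.

(** [Re] and [Im] are real-linear, so they commute with difference quotients, and [cvgCP] applies to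
    these. *)
Lemma is_deriveCP f x z :
  is_derive x 1 f z <->
  is_derive x 1 (Re \o f) (Re z) /\ is_derive x 1 (Im \o f) (Im z).
Proof.
have eR h : Re (h^-1 *: (f (h *: 1 + x) - f x)) =
    h^-1 *: ((Re \o f) (h *: 1 + x) - (Re \o f) x).
  by rewrite complexReZ complexReB.
have eI h : Im (h^-1 *: (f (h *: 1 + x) - f x)) =
    h^-1 *: ((Im \o f) (h *: 1 + x) - (Im \o f) x).
  by rewrite complexImZ complexImB.
split=> [[df <-]|[[dr er] [di ei]]].
  have /cvgCP[] := df; under eq_fun do rewrite eR; move=> hr.
  under eq_fun do rewrite eI; move=> hi.
  split; apply: DeriveDef; first exact: cvgP hr.
  - by rewrite /derive; exact/cvg_lim.
  - exact: cvgP hi.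
  - by rewrite /derive; exact/cvg_lim.
have hf : h^-1 *: (f (h *: 1 + x) - f x) @[h --> 0^'] --> z.
  apply/cvgCP; split.
    under eq_fun do rewrite eR; rewrite -er; exact: dr.
  under eq_fun do rewrite eI; rewrite -ei; exact: di.
by apply: DeriveDef; [exact: cvgP hf | rewrite /derive; exact/cvg_lim].
Qed.

Lemma is_derive1E f x z : is_derive x 1 f z -> derive1 f x = z.
Proof. by move=> [_ <-]; rewrite derive1E. Qed.

Lemma derivable_is_derive1 f x : derivable f x 1 ->
  is_derive x 1 f (derive1 f x).
Proof. by move=> fx; rewrite derive1E; exact: derivableP. Qed.

Lemma is_deriveCM f g x z w : is_derive x 1 f z -> is_derive x 1 g w ->
  is_derive x 1 (f * g) (z * g x + f x * w).
Proof.
move=> /is_deriveCP[fr fi] /is_deriveCP[gr gi]; apply/is_deriveCP.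
have -> : Re \o (f * g) = (Re \o f) * (Re \o g) - (Im \o f) * (Im \o g).
  by apply/funext => y /=; rewrite complexReM.
have -> : Im \o (f * g) = (Re \o f) * (Im \o g) + (Im \o f) * (Re \o g).
  by apply/funext => y /=; rewrite complexImM.
rewrite complexReD complexImD !complexReM !complexImM.
split;
  [apply: (is_derive_eq (is_deriveB (is_deriveM fr gr) (is_deriveM fi gi))) |
   apply: (is_derive_eq (is_deriveD (is_deriveM fr gi) (is_deriveM fi gr)))].
all: rewrite /GRing.scale /=.
all:  move: (Re z) (Im z) (Re w) (Im w) (f x) (g x) => a b c d [p q] [r s] /=.
all: ring.
Qed.

Lemma derivable_continuous f x : derivable f x 1 -> {for x, continuous f}.
Proof. by move=> /derivable1_diffP/differentiable_continuous. Qed.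

(** The bound on [du] is asked on the interval centred at [a] with radius [|b - a|], so that a
    single hypothesis serves both orders of [a] and [b]. *)
Lemma real_mean_value (u du : R -> R) a b M :
  (forall x, is_derive x 1 u (du x)) ->
  (forall x, `|x - a| <= `|b - a| -> `|du x| <= M) ->
  `|u b - u a| <= M * `|b - a|.
Proof.
move=> uD uM.
have uc s : {within s, continuous u}.
  apply/continuous_subspaceT => x; apply/differentiable_continuous.
  by apply/derivable1_diffP; case: (uD x).
have [ab|ba] := leP a b.
  have [c /itvP cab ->] := MVT_segment ab (fun x _ => uD x) (uc _).
  rewrite normrM ler_wpM2r//; apply: uM.
  by rewrite !ger0_norm ?subr_ge0 ?cab// lerB ?cab.
have [c /itvP cab e] := MVT_segment (ltW ba) (fun x _ => uD x) (uc _).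
rewrite distrC e normrM [`|b - a|]distrC ler_wpM2r//; apply: uM.
rewrite distrC [`|b - a|]distrC !ger0_norm ?subr_ge0 ?cab// ?(ltW ba)//.
by rewrite lerB ?cab.
Qed.

(* The mean value inequality is applied to the real and imaginary parts
   separately, whence the factor [2]. *)
Lemma mean_value f (df : R -> C) (a b M : R) :
  (forall x, is_derive x 1 f (df x)) ->
  (forall x, `|x - a| <= `|b - a| -> `|df x| <= M) ->
  `|f b - f a| <= 2 * M * `|b - a|.
Proof.
move=> fD dfM.
have fR x : is_derive x 1 (Re \o f) (Re (df x)) by have /is_deriveCP[] := fD x.
have fI x : is_derive x 1 (Im \o f) (Im (df x)) by have /is_deriveCP[] := fD x.
have hR : `|(Re \o f) b - (Re \o f) a| <= M * `|b - a|.
  by apply: real_mean_value fR _ => x /dfM; apply: le_trans (norm_Re_le _).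
have hI : `|(Im \o f) b - (Im \o f) a| <= M * `|b - a|.
  by apply: real_mean_value fI _ => x /dfM; apply: le_trans (norm_Im_le _).
apply: le_trans (norm_le_ReIm _) _; rewrite complexReB complexImB.
rewrite -mulrA mulr_natl mulr2n; exact: lerD.
Qed.

(** Two uses of [mean_value]: for [df] it gives [|df t - df x| <= 2 * M * |h|]; for
    [r t = f t - t *: df x], whose derivative is [df t - df x], it contributes a further factor
    [2 * |h|]. *)
Lemma taylor1 f (df ddf : R -> C) M :
  (forall x, is_derive x 1 f (df x)) -> (forall x, is_derive x 1 df (ddf x)) ->
  (forall x, `|ddf x| <= M) ->
  forall x h, `|f (x + h) - f x - h *: df x| <= 4 * M * `|h| ^+ 2.
Proof.
move=> fD dfD ddfM x h.
pose r (t : R) : C := f t - t *: df x.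
have rD (t : R) : is_derive t 1 r (df t - df x).
  have dz : is_derive t 1 (fun t : R => t *: df x) (df x).
    apply/is_deriveCP; rewrite (_ : Re \o _ = (Re (df x) *: @id R)); last first.
      by apply/funext => s /=; rewrite complexReZ mulrC.
    rewrite (_ : Im \o _ = (Im (df x) *: @id R)); last first.
      by apply/funext => s /=; rewrite complexImZ mulrC.
    split; apply: is_derive_eq; exact: mulr1.
  exact: is_deriveB.
have M0 : 0 <= M by apply: le_trans (ddfM 0); exact: normr_ge0.
have rM t : `|t - x| <= `|x + h - x| -> `|df t - df x| <= 2 * M * `|h|.
  rewrite (addrC x) addrK => tx; apply: le_trans (mean_value dfD _) _.
    by move=> y _; exact: ddfM.
  by rewrite ler_wpM2l// mulr_ge0.
have := mean_value rD rM; rewrite /r (addrC x) addrK scalerDl.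
have -> (A B P Q : C) : A - (P + Q) - (B - Q) = A - B - P.
  by rewrite opprB opprD !addrA subrK addrAC.
by move=> /le_trans; apply; rewrite expr2 le_eqVlt; apply/orP; left;
  apply/eqP; ring.
Qed.

(** A partial converse of [taylor1]: after division by [h], the remainder is at most [K * |h|]. A
    quadratic bound survives limits and integration, which makes differentiation under both
    possible. *)
Lemma quadratic_is_derive f z x K :
  (forall h, `|f (x + h) - f x - h *: z| <= K * `|h| ^+ 2) -> is_derive x 1 f z.
Proof.
move=> fK.
have hf : h^-1 *: (f (h *: 1 + x) - f x) @[h --> (0 : R)^'] --> z.
  apply/cvgrPdist_le => e e0.
  (* [K] has no prescribed sign; [|K| + 1] is a positive majorant by which [e] can be divided. *)
  have K0 : 0 < `|K| + 1 by rewrite ltr_pwDr.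
  near=> h.
  have h0 : h != 0 by near: h; exact: nbhs_dnbhs_neq.
  rewrite distrC (_ : _ - _ = h^-1 *: (f (x + h) - f x - h *: z)); last first.
    by rewrite [h *: 1]mulr1 (addrC h) [RHS]scalerBr scalerA mulVf// scale1r.
  rewrite normrZ normfV ler_pdivrMl ?normr_gt0//.
  apply: le_trans (fK h) _; rewrite expr2 mulrCA ler_wpM2l//.
  have : `|h| <= e / (`|K| + 1).
    near: h; apply: dnbhs0_le; exact: divr_gt0.
  rewrite ler_pdivlMr// => /(le_trans _); apply; rewrite mulrC ler_wpM2l//.
  by rewrite (le_trans (ler_norm _))// lerDl.
by apply: DeriveDef; [exact: cvgP hf | rewrite /derive; exact/cvg_lim].
Unshelve. all: by end_near. Qed.

End ComplexValued.

(** * The space [DLinf]: sup norms, Leibniz formula, completeness *)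

Section SmoothBounded.
Variable R : realType.
Local Notation C := (Rcomplex R).
Local Notation Re := (@complex.Re R).
Local Notation Im := (@complex.Im R).
Local Notation mu := (@lebesgue_measure R).
Implicit Types (x : R) (z w : C) (f g : R -> C).

Lemma cvg_norm_le T (F : set_system T) {FF : ProperFilter F} (v : T -> C) z
    (M : R) :
  v x @[x --> F] --> z -> (\forall x \near F, `|v x| <= M) -> `|z| <= M.
Proof.
move=> /cvgrPdist_le vz vM; apply/ler_addgt0Pr => e e0.
have [t [vt vt']] := filter_ex (filterI (vz _ e0) vM).
by rewrite -(subrK (v t) z) (le_trans (ler_normD _ _))// addrC lerD.
Qed.

Lemma near2_natP (P : nat -> nat -> Prop) :
  (\forall i & j \near \oo, P i j) <->
  exists N, forall i j, (N <= i)%N -> (N <= j)%N -> P i j.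
Proof.
split=> [[[A B] [[a _ aA] [b _ bB]] AB]|[N NP]].
  exists (maxn a b) => i j; rewrite !geq_max => /andP[ai _] /andP[_ bj].
  by apply: (AB (i, j)); split => /=; [exact: aA|exact: bB].
exists ([set i | (N <= i)%N], [set i | (N <= i)%N]).
  by split; exists N.
by case=> i j /= [] *; exact: NP.
Qed.

Lemma Rcomplex_cauchy_cvg (v : nat -> C) :
  (forall e : R, 0 < e ->
    exists N, forall i j, (N <= i)%N -> (N <= j)%N -> `|v i - v j| <= e) ->
  exists z : C, v n @[n --> \oo] --> z.
Proof.
move=> vC.
(* A 1-Lipschitz [p] maps [v] to a real Cauchy sequence; it will be [Re], then [Im]. *)
have H (p : C -> R) : (forall z w, `|p z - p w| <= `|z - w|) ->
    exists a : R, p (v n) @[n --> \oo] --> a.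
  move=> p1; suff pv : cvgn (p \o v) by exists (lim (p \o v @ \oo)).
  apply/cauchy_cvgP/cauchy_ballP => e e0; near_simpl.
  have [|N NP] := vC (e / 2); first by rewrite divr_gt0.
  apply/near2_natP; exists N => i j Ni Nj; rewrite /= -ball_normE /=.
  apply: le_lt_trans (p1 _ _) _; apply: le_lt_trans (NP _ _ Ni Nj) _.
  by rewrite ltr_pdivrMr// ltr_pMr// ltr1n.
have [a ha] : exists a : R, Re (v n) @[n --> \oo] --> a.
  by apply: H => z w; rewrite -complexReB; exact: norm_Re_le.
have [b hb] : exists b : R, Im (v n) @[n --> \oo] --> b.
  by apply: H => z w; rewrite -complexImB; exact: norm_Im_le.
by exists (Complex a b); apply/cvgCP.
Qed.

Lemma continuousCP f :
  continuous f <-> continuous (Re \o f) /\ continuous (Im \o f).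
Proof.
split=> [fc|[fr fi] x]; last by apply/cvgCP; split; [exact: fr|exact: fi].
by split=> x; have /cvgCP[] := fc x.
Qed.

Lemma continuous_Cmeasurable f : continuous f -> Cmeasurable f.
Proof.
by move=> /continuousCP[fr fi]; split; exact: continuous_measurable_fun.
Qed.

(** The set where [M < |f|] is open: if it were not empty, it would contain a ball, of positive
    measure, inside a null set. *)
Lemma ae_le_continuous f M : continuous f ->
  (\forall x \ae mu, `|f x| <= M) -> forall x, `|f x| <= M.
Proof.
move=> fc [N [mN N0 fN]] x; rewrite leNgt; apply/negP => Mfx.
have /nbhs_ballP[r r0 xr] : \forall y \near x, M < `|f y|.
  exact: (cvgr_gt _ (cvg_norm (fc x))).
have mB : measurable (ball x r) by exact: measurable_ball.
have : (mu (ball x r) <= mu N)%E.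
  apply: le_measure; rewrite ?inE// => y yr.
  by apply: fN => /=; apply/negP; rewrite -ltNge; exact: xr.
have -> : mu N = 0%E by exact: N0.
by rewrite (lebesgue_measure_ball x (ltW r0)) lee_fin leNgt pmulrn_lgt0// r0.
Qed.

Lemma CLnorm_infty_le f M : continuous f ->
  (CLnorm +oo f <= M%:E)%E <-> forall x, `|f x| <= M.
Proof.
(* The norm of exponent [+oo] is defined as an essential supremum only if the whole space has
   positive measure, which is checked first. *)
move=> fc; rewrite /CLnorm Lnorm.unlock ifT; last first.
  have := lebesgue_measure_itv (`]-oo, +oo[ : interval R).
  rewrite set_itvNyy/= => h.
  suff : (0 < mu (@setT R))%E by [].
  by rewrite h; exact: ltry.
split=> [/ess_supP h|h].
  apply: ae_le_continuous => //; apply: filterS h => y /=.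
  by rewrite lee_fin normr_id.
by apply/ess_supP; apply: aeW => y /=; rewrite lee_fin normr_id.
Qed.

Lemma Lp_inftyP f : continuous f ->
  Lp +oo f <-> exists M, forall x, `|f x| <= M.
Proof.
move=> fc; split=> [[_ foo]|[M fM]].
  exists (fine (CLnorm +oo f)); apply/CLnorm_infty_le => //; rewrite fineK//.
  by rewrite ge0_fin_numE// Lnorm_ge0.
split; first exact: continuous_Cmeasurable.
by apply: le_lt_trans (ltry M); apply/CLnorm_infty_le.
Qed.

Lemma norm_le_CLnorm f x : continuous f -> Lp +oo f ->
  `|f x| <= fine (CLnorm +oo f).
Proof.
move=> fc [_ foo]; move: x; apply/CLnorm_infty_le => //; rewrite fineK//.
by rewrite ge0_fin_numE// Lnorm_ge0.
Qed.

Lemma fine_CLnorm_le f M : continuous f -> (forall x, `|f x| <= M) ->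
  fine (CLnorm +oo f) <= M.
Proof.
move=> fc fM; have h := (CLnorm_infty_le M fc).2 fM; rewrite -lee_fin fineK//.
by rewrite ge0_fin_numE ?Lnorm_ge0// (le_lt_trans h)// ltry.
Qed.

Lemma smooth_continuous f i : smooth f -> continuous (derive1n i f).
Proof. by move=> fs x; exact: derivable_continuous. Qed.

Lemma smooth_is_derive f i x : smooth f ->
  is_derive x 1 (derive1n i f) (derive1n i.+1 f x).
Proof. by move=> fs; exact: derivable_is_derive1. Qed.

(** A candidate for every derivative, each differentiating to the next, gives smoothness and all
    iterated derivatives at once. Sums, products, limits and convolutions are all treated in this
    way. *)
Lemma derive1n_family (F : nat -> R -> C) :
  (forall i x, is_derive x 1 (F i) (F i.+1 x)) ->
  smooth (F 0%N) /\ forall i, derive1n i (F 0%N) = F i.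
Proof.
move=> FD; have FE i : derive1n i (F 0%N) = F i.
  elim: i => [//|i ih]; rewrite derive1nS ih.
  by apply/funext => x; exact: is_derive1E.
by split=> // i x; rewrite FE; case: (FD i x).
Qed.

Lemma smooth_derive1 f : smooth f -> smooth (derive1 f).
Proof. by move=> fs i x; rewrite -derive1Sn. Qed.

Lemma smoothD f g : smooth f -> smooth g -> smooth (f + g) /\
  forall i, derive1n i (f + g) = derive1n i f + derive1n i g.
Proof.
move=> fs gs; pose F i : R -> C := derive1n i f + derive1n i g.
apply: (@derive1n_family F) => i x.
by apply: is_deriveD; exact: smooth_is_derive.
Qed.

Lemma smoothB f g : smooth f -> smooth g -> smooth (f - g) /\
  forall i, derive1n i (f - g) = derive1n i f - derive1n i g.
Proof.
move=> fs gs; pose F i : R -> C := derive1n i f - derive1n i g.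
apply: (@derive1n_family F) => i x.
by apply: is_deriveB; exact: smooth_is_derive.
Qed.

Lemma smooth_cstM z f : smooth f -> smooth (cst z * f) /\
  forall i, derive1n i (cst z * f) = cst z * derive1n i f.
Proof.
move=> fs; pose F i : R -> C := cst z * derive1n i f.
apply: (@derive1n_family F) => i x.
have := is_deriveCM (is_derive_cst z x 1) (smooth_is_derive i x fs).
by rewrite mul0r add0r.
Qed.

Lemma smooth0 : smooth (0 : R -> C) /\ forall i, derive1n i (0 : R -> C) = 0.
Proof.
apply: (@derive1n_family (fun=> 0)) => i x; exact: is_derive_cst.
Qed.

(* [leibniz n f g] is the [n]-th derivative of [f * g], written as a sum of
   [2 ^ n] terms without grouping equal ones. *)
Fixpoint leibniz n f g : R -> C :=
  if n is m.+1 then leibniz m (derive1 f) g + leibniz m f (derive1 g)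
  else f * g.

Lemma smoothM f g : smooth f -> smooth g -> smooth (f * g) /\
  forall i, derive1n i (f * g) = leibniz i f g.
Proof.
move=> fs gs; apply: (@derive1n_family (fun i => leibniz i f g)) => i x.
elim: i => [|i ih] in f g fs gs *.
  by apply: is_deriveCM; exact: (smooth_is_derive 0).
by apply: is_deriveD; apply: ih => //; exact: smooth_derive1.
Qed.

(** Each of the [2 ^ n] terms is a derivative of [f] times a derivative of [g], both of order at
    most [n]. *)
Lemma leibniz_le n f g (A B : R) :
  (forall i x, (i <= n)%N -> `|derive1n i f x| <= A) ->
  (forall i x, (i <= n)%N -> `|derive1n i g x| <= B) ->
  forall x, `|leibniz n f g x| <= 2 ^+ n * (A * B).
Proof.
elim: n f g => [|n ih] f g fA gB x /=.
  by rewrite mul1r Rcomplex_normrM ler_pM//; [exact: (fA 0%N)|exact: (gB 0%N)].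
rewrite exprS -mulrA mulr_natl mulr2n.
apply: le_trans (ler_normD _ _) _; apply: lerD; apply: ih => i y ni.
- by rewrite -derive1Sn; exact: fA.
- by apply: gB; exact: leqW.
- by apply: fA; exact: leqW.
- by rewrite -derive1Sn; exact: gB.
Qed.

(** The derivatives of a smooth function are continuous, so essential bounds on them are bounds at
    every point. *)
Lemma DLinfP f : DLinf f <->
  smooth f /\ forall i, exists M, forall x, `|derive1n i f x| <= M.
Proof.
by split=> -[fs fM]; split=> // i; apply/Lp_inftyP => //;
  exact: smooth_continuous.
Qed.

Lemma norm_le_Dnorm f m i x : DLinf f -> (i <= m)%N ->
  `|derive1n i f x| <= Dnorm m f.
Proof.
move=> [fs fL] im; have im1 : (i < m.+1)%N by [].
rewrite /Dnorm (bigD1 (Ordinal im1))//= ler_wpDr//.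
  by apply: sumr_ge0 => j _; rewrite fine_ge0// Lnorm_ge0.
by apply: norm_le_CLnorm => //; exact: smooth_continuous.
Qed.

Lemma Dnorm_le f m (M : R) : smooth f ->
  (forall i x, (i <= m)%N -> `|derive1n i f x| <= M) ->
  Dnorm m f <= m.+1%:R * M.
Proof.
move=> fs fM; rewrite /Dnorm mulr_natl.
rewrite -[leRHS](_ : \sum_(i < m.+1) M = _); last first.
  by rewrite sumr_const card_ord.
apply: ler_sum => i _; apply: fine_CLnorm_le; first exact: smooth_continuous.
by move=> x; apply: fM; rewrite -ltnS.
Qed.

Lemma Dnorm_ge0 m f : 0 <= Dnorm m f.
Proof. by apply: sumr_ge0 => j _; rewrite fine_ge0// Lnorm_ge0. Qed.

Lemma Dnorm_nondecreasing m n f : (m <= n)%N -> Dnorm m f <= Dnorm n f.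
Proof.
move=> /subnK <-; elim: (n - m)%N => [//|k ih]; apply: le_trans ih _.
by rewrite addSn /Dnorm [leRHS]big_ord_recr/= lerDl fine_ge0// Lnorm_ge0.
Qed.

Lemma DnormD m f g : DLinf f -> DLinf g ->
  Dnorm m (f + g) <= Dnorm m f + Dnorm m g.
Proof.
move=> [fs fL] [gs gL]; rewrite /Dnorm -big_split/=; apply: ler_sum => i _.
have [fgs ->] := smoothD fs gs.
apply: fine_CLnorm_le => [x|x].
  by apply: continuousD; exact: smooth_continuous.
by apply: le_trans (ler_normD _ _) _; apply: lerD; apply: norm_le_CLnorm => //;
  exact: smooth_continuous.
Qed.

Lemma DLinf_cstM z f : DLinf f -> DLinf (cst z * f).
Proof.
move=> /DLinfP[fs fM]; apply/DLinfP.
have [zfs zfE] := smooth_cstM z fs; split=> // i.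
have [M hM] := fM i; exists (`|z| * M) => x.
by rewrite zfE Rcomplex_normrM ler_wpM2l.
Qed.

Lemma DLinfD f g : DLinf f -> DLinf g -> DLinf (f + g).
Proof.
move=> /DLinfP[fs fM] /DLinfP[gs gM]; apply/DLinfP.
have [fgs fgE] := smoothD fs gs; split=> // i.
have [M hM] := fM i; have [N hN] := gM i; exists (M + N) => x.
by rewrite fgE (le_trans (ler_normD _ _))// lerD.
Qed.

Lemma DLinf0 : DLinf (0 : R -> C).
Proof.
apply/DLinfP; have [s0 E0] := smooth0; split=> // i; exists 0 => x.
by rewrite E0 normr0.
Qed.

Lemma DLinfM f g : DLinf f -> DLinf g -> DLinf (f * g).
Proof.
move=> fD gD; apply/DLinfP.
have [fgs fgE] := smoothM fD.1 gD.1; split=> // i.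
exists (2 ^+ i * (Dnorm i f * Dnorm i g)) => x; rewrite fgE.
by apply: leibniz_le => j y ji; exact: norm_le_Dnorm.
Qed.

(** The factor [m.+1] counts the derivatives summed in [Dnorm], and [2 ^+ m] bounds the number of
    Leibniz terms of each. *)
Lemma DnormM m f g : DLinf f -> DLinf g ->
  Dnorm m (f * g) <= m.+1%:R * 2 ^+ m * (Dnorm m f * Dnorm m g).
Proof.
move=> fD gD; have [fgs fgE] := smoothM fD.1 gD.1.
rewrite -mulrA; apply: Dnorm_le => // i x im; rewrite fgE.
apply: (@le_trans _ _ (2 ^+ i * (Dnorm m f * Dnorm m g))).
  by apply: leibniz_le => j y ji; apply: norm_le_Dnorm => //;
    exact: leq_trans ji im.
by rewrite ler_wpM2r ?mulr_ge0 ?Dnorm_ge0// ler_weXn2l// ler1n.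
Qed.

Lemma DnormZ_le m z f : DLinf f -> Dnorm m (cst z * f) <= `|z| * Dnorm m f.
Proof.
move=> [fs fL]; rewrite /Dnorm mulr_sumr; apply: ler_sum => i _.
have [zfs zfE] := smooth_cstM z fs.
apply: fine_CLnorm_le => [|x]; first exact: smooth_continuous.
rewrite zfE Rcomplex_normrM ler_wpM2l//; apply: norm_le_CLnorm => //.
exact: smooth_continuous.
Qed.

(** For [z != 0], the reverse of [DnormZ_le] is [DnormZ_le] itself, applied to [z^-1] and
    [cst z * f]. *)
Lemma DnormZ m z f : DLinf f -> Dnorm m (cst z * f) = `|z| * Dnorm m f.
Proof.
move=> fD; apply/eqP; rewrite eq_le DnormZ_le//=.
have [->|z0] := eqVneq z 0; first by rewrite normr0 mul0r Dnorm_ge0.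
rewrite -[X in Dnorm m X](_ : cst z^-1 * (cst z * f) = f); last first.
  by apply/funext => x; rewrite !fctE mulrA mulVf// mul1r.
apply: (@le_trans _ _ (`|z| * (`|z^-1 : C| * Dnorm m (cst z * f)))).
  by rewrite ler_wpM2l// DnormZ_le//; exact: DLinf_cstM.
by rewrite mulrA -Rcomplex_normrM divff// Rcomplex_norm1 mul1r.
Qed.

Lemma DLinfB f g : DLinf f -> DLinf g -> DLinf (f - g).
Proof.
move=> fD gD; rewrite (_ : f - g = f + cst (-1) * g).
  by apply: DLinfD => //; exact: DLinf_cstM.
by apply/funext => x; rewrite !fctE mulN1r.
Qed.

(** For each [i], the derivatives of order [i] converge uniformly to some [G i]. Passing to the
    limit in Taylor's remainder bound shows that [G i.+1] is the derivative of [G i], so [G 0] is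
    the limit sought. *)
Lemma DLinf_complete_lim (u : nat -> R -> C) : (forall n, DLinf (u n)) ->
  (forall m (e : R), 0 < e ->
    \forall i & j \near \oo, Dnorm m (u i - u j) < e) ->
  exists2 f, DLinf f &
    forall m e, 0 < e -> \forall n \near \oo, Dnorm m (u n - f) < e.
Proof.
move=> uD uC.
have us n := (uD n).1.
have uCi i e : 0 < e -> exists N, forall j k x, (N <= j)%N -> (N <= k)%N ->
    `|derive1n i (u j) x - derive1n i (u k) x| <= e.
  move=> /(uC i)/near2_natP[N hN]; exists N => j k x Nj Nk.
  have [_ dB] := smoothB (us j) (us k).
  have := norm_le_Dnorm x (DLinfB (uD j) (uD k)) (leqnn i).
  by rewrite dB => /le_trans; apply; exact/ltW/hN.
(* Order and point are paired so that one use of [choice] yields all the limits. *)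
have uF (ix : nat * R) : exists z : C,
    derive1n ix.1 (u n) ix.2 @[n --> \oo] --> z.
  case: ix => i x; apply: Rcomplex_cauchy_cvg => e /(uCi i)[N hN].
  by exists N => j k Nj Nk; exact: hN.
have [F FE] := choice uF; pose G i x := F (i, x).
have uG i x : derive1n i (u n) x @[n --> \oo] --> G i x := FE (i, x).
(* Letting [k] tend to infinity in [uCi] makes the convergence uniform in [x]. *)
have GN i e : 0 < e -> exists N, forall j x, (N <= j)%N ->
    `|derive1n i (u j) x - G i x| <= e.
  move=> /(uCi i)[N hN]; exists N => j x Nj; rewrite distrC.
  apply: (cvg_norm_le (cvgB (uG i x) (cvg_cst _))).
  by exists N => // k Nk; exact: hN.
have GM i : exists M, exists N, forall j x, (N <= j)%N ->
    `|derive1n i (u j) x| <= M.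
  have [N hN] := GN i 1 ltr01.
  (* One unit bounds the distance from [u N] to [G i], the other that from [G i] to [u j], both for
     derivatives of order [i]. *)
  exists (Dnorm i (u N) + 1 + 1); exists N => j x Nj.
  have h1 := norm_le_Dnorm x (uD N) (leqnn i).
  have h2 := hN _ x Nj; have := hN _ x (leqnn N); rewrite distrC => h3.
  set a := derive1n i (u j) x in h2 *; set b := derive1n i (u N) x in h1 h3.
  have -> : a = (a - G i x) + ((G i x - b) + b) by rewrite !subrK.
  have := ler_normD (a - G i x) ((G i x - b) + b).
  have := ler_normD (G i x - b) b; lra.
have GD i (x : R) : is_derive x 1 (G i) (G i.+1 x).
  (* The constant in Taylor's bound must not depend on [n]: this is what the uniform bound on
     derivatives of order [i.+2] provides. *)
  have [M [N hM]] := GM i.+2.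
  apply: (@quadratic_is_derive _ _ _ _ (4 * M)) => h.
  have lim_rem : (derive1n i (u n) (x + h) - derive1n i (u n) x -
      h *: derive1n i.+1 (u n) x) @[n --> \oo] -->
      G i (x + h) - G i x - h *: G i.+1 x.
    apply: cvgB; first exact: cvgB (uG i (x + h)) (uG i x).
    exact: cvgZ (cvg_cst h) (uG i.+1 x).
  apply: (cvg_norm_le lim_rem); exists N => // n Nn /=.
  apply: (taylor1 (fun y => smooth_is_derive i y (us n))
                  (fun y => smooth_is_derive i.+1 y (us n))) => y.
  exact: hM.
have [Gs GE] := derive1n_family GD.
have GDL : DLinf (G 0%N).
  apply/DLinfP; split=> // i; have [M [N hM]] := GM i; exists M => x.
  rewrite GE; apply: (cvg_norm_le (uG i x)); by exists N => // n; exact: hM.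
exists (G 0%N) => // m e e0.
(* [Dnorm m] has [m.+1] terms; dividing by [m.+2] keeps the final inequality strict. *)
have e1 : 0 < e / (m.+2)%:R by rewrite divr_gt0.
have [N hN] : exists N, forall i j x, (i <= m)%N -> (N <= j)%N ->
    `|derive1n i (u j) x - G i x| <= e / m.+2%:R.
  have [n hn] := choice (fun i => GN i _ e1).
  exists (\max_(i < m.+1) n i) => i j x im nj; apply: hn; apply: leq_trans nj.
  exact: (@leq_bigmax _ (fun i : 'I_m.+1 => n i) (Ordinal (im : i < m.+1)%N)).
exists N => // j Nj /=; have [jGs jGE] := smoothB (us j) Gs.
apply: (@le_lt_trans _ _ (m.+1%:R * (e / m.+2%:R))).
  by apply: Dnorm_le => // i x im; rewrite jGE GE; exact: hN.
by rewrite mulrCA gtr_pMr// ltr_pdivrMr// mul1r ltr_nat.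
Qed.

End SmoothBounded.

(** * Almost automorphic functions: diagonal extraction, uniform limits, derivatives *)

Section AlmostAutomorphic.
Variable R : realType.
Local Notation C := (Rcomplex R).
Local Notation Re := (@complex.Re R).
Local Notation Im := (@complex.Im R).
Implicit Types (x : R) (z w : C) (f g : R -> C) (s t : nat -> R).

(** The sequence is a parameter, already extracted, so that several functions can share it. *)
Definition aa_along f t g : Prop :=
  (forall x, f (x + t n) @[n --> \oo] --> g x) /\
  (forall x, g (x - t n) @[n --> \oo] --> f x).

Lemma cvg_natP (v : nat -> C) z : v n @[n --> \oo] --> z <->
  forall e, 0 < e -> exists N, forall n, (N <= n)%N -> `|z - v n| <= e.
Proof.
split=> [/cvgrPdist_le h e /h[N _ hN]|h]; first by exists N => n; exact: hN.
by apply/cvgrPdist_le => e /h[N hN]; exists N.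
Qed.

(** Fitted to diagonal sequences, which run through terms of a given extraction only from some rank
    on. *)
Lemma cvg_cofinal (v w : nat -> C) z (N : nat) :
  (forall j, (N <= j)%N -> exists2 i, (j <= i)%N & w j = v i) ->
  v n @[n --> \oo] --> z -> w n @[n --> \oo] --> z.
Proof.
move=> wv /cvg_natP vz; apply/cvg_natP => e /vz[n hn].
exists (maxn N n) => j; rewrite geq_max => /andP[/wv[i ji ->] nj].
by apply: hn; exact: leq_trans nj ji.
Qed.

Lemma aa_along_cofinal f g s t (N : nat) :
  (forall j, (N <= j)%N -> exists2 i, (j <= i)%N & t j = s i) ->
  aa_along f s g -> aa_along f t g.
Proof.
move=> ts [fg gf]; split=> x.
  by apply: cvg_cofinal (fg x) => j /ts[i ji ->]; exists i.
by apply: cvg_cofinal (gf x) => j /ts[i ji ->]; exists i.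
Qed.

Lemma homo_ltn_ge (k : nat -> nat) :
  {homo k : m n / (m < n)%N} -> forall n, (n <= k n)%N.
Proof. by move=> kI; elim=> // n ih; apply: leq_ltn_trans ih (kI _ _ _). Qed.

Lemma cvgCM (v w : nat -> C) (y z : C) : v n @[n --> \oo] --> y ->
  w n @[n --> \oo] --> z -> (v n * w n : C) @[n --> \oo] --> (y * z : C).
Proof.
move=> /cvgCP[vr vi] /cvgCP[wr wi]; apply/cvgCP.
rewrite complexReM complexImM; split.
  under eq_fun do rewrite complexReM; exact: cvgB (cvgM vr wr) (cvgM vi wi).
under eq_fun do rewrite complexImM; exact: cvgD (cvgM vr wi) (cvgM vi wr).
Qed.

Lemma aa_alongD f1 f2 g1 g2 t : aa_along f1 t g1 -> aa_along f2 t g2 ->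
  aa_along (f1 + f2) t (g1 + g2).
Proof.
move=> [a b] [c d]; split=> x.
  exact: cvgD (a x) (c x).
exact: cvgD (b x) (d x).
Qed.

Lemma aa_alongM f1 f2 g1 g2 t : aa_along f1 t g1 -> aa_along f2 t g2 ->
  aa_along (f1 * f2) t (g1 * g2).
Proof.
move=> [a b] [c d]; split=> x.
  exact: cvgCM (a x) (c x).
exact: cvgCM (b x) (d x).
Qed.

Lemma aa_along_cst z t : aa_along (cst z) t (cst z).
Proof. by split=> x; exact: cvg_cst. Qed.

Lemma aa_along_shift f g t h : aa_along f t g ->
  aa_along (fun x => f (x + h)) t (fun x => g (x + h)).
Proof.
move=> [a b]; split=> x.
  by under eq_fun do rewrite addrAC; exact: a.
by under eq_fun do rewrite addrAC; exact: b.
Qed.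

(** The three-epsilon argument: [w] is close to [v] uniformly in [n], and their limits are close
    too. *)
Lemma cvg_approx (v : nat -> C) z :
  (forall e, 0 < e -> exists (w : nat -> C) (a : C), [/\ w n @[n --> \oo] --> a,
     forall n, `|v n - w n| <= e & `|z - a| <= e]) ->
  v n @[n --> \oo] --> z.
Proof.
move=> H; apply/cvg_natP => e e0.
have [|w [a [/cvg_natP wa vw za]]] := H (e / 3); first by rewrite divr_gt0.
have [|N hN] := wa (e / 3); first by rewrite divr_gt0.
exists N => n /hN wn.
rewrite (_ : z - v n = (z - a) + ((a - w n) - (v n - w n))); last first.
  by rewrite opprB !addrA subrK subrK.
apply: le_trans (ler_normD _ _) _.
have := ler_normB (a - w n) (v n - w n); have := vw n; lra.
Qed.

Lemma cvg_approx_ex (v : nat -> C) :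
  (forall e, 0 < e -> exists (w : nat -> C) (a : C), w n @[n --> \oo] --> a /\
     forall n, `|v n - w n| <= e) ->
  exists z : C, v n @[n --> \oo] --> z.
Proof.
move=> H; apply: Rcomplex_cauchy_cvg => e e0.
have [|w [a [/cvg_natP wa vw]]] := H (e / 4); first by rewrite divr_gt0.
have [|N hN] := wa (e / 4); first by rewrite divr_gt0.
exists N => i j /hN wi /hN wj.
(* Four differences, each of modulus at most [e / 4]. *)
have -> : v i - v j =
    ((v i - w i) - (a - w i)) + ((a - w j) - (v j - w j)).
  by rewrite !opprB !addrA !subrK.
apply: le_trans (ler_normD _ _) _.
have := ler_normB (v i - w i) (a - w i).
have := ler_normB (a - w j) (v j - w j).
have := vw i; have := vw j; lra.
Qed.

Lemma aa_along_approx f t :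
  (forall e, 0 < e -> exists p q, aa_along p t q /\
    forall x, `|f x - p x| <= e) ->
  exists g, aa_along f t g.
Proof.
move=> H.
have fx x : exists z : C, f (x + t n) @[n --> \oo] --> z.
  apply: cvg_approx_ex => e /H[p [q [[pq _] fp]]].
  by exists (fun n => p (x + t n)), (q x).
have [g fg] := choice fx; exists g; split=> // x.
apply: cvg_approx => e /H[p [q [[pq qp] fp]]].
exists (fun n => q (x - t n)), (p x); split=> // n.
(* The uniform bound on [f - p] passes to the limits [g] and [q] of the translates. *)
by apply: (cvg_norm_le (cvgB (fg _) (pq _))); exact: nearW.
Qed.

(** Otherwise some [s] satisfies [n < |f (s n)|] for all [n], while [f (0 + s (k n))] converges for
    an extraction [k], with [n <= k n]. *)
Lemma Caa_bounded f : Caa f -> exists M, forall x, `|f x| <= M.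
Proof.
move=> [_ aaf]; apply: contrapT => /forallNP fM.
have fn (n : nat) : exists x : R, n%:R < `|f x|.
  apply: contrapT => /forallNP h; apply: (fM n%:R) => x.
  by rewrite leNgt; apply/negP/h.
have [s hs] := choice fn.
have [k [kI [g [fg _]]]] := aaf s.
have /cvg_natP/(_ 1 ltr01)[N hN] := fg 0.
near \oo => n.
have Nn : (N <= n)%N by near: n; exact: nbhs_infty_ge.
have gn : `|g 0| + 1 <= n%:R by near: n; exact: nbhs_infty_ger.
have := hN _ Nn; rewrite add0r => fgn; have := hs (k n).
apply/negP; rewrite -leNgt.
apply: (@le_trans _ _ (`|g 0| + 1)).
  rewrite -(subKr (g 0) (f _)); apply: le_trans (ler_normB _ _) _.
  by rewrite lerD2l.
by apply: le_trans gn _; rewrite ler_nat homo_ltn_ge.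
Unshelve. all: by end_near. Qed.

(** Cantor's diagonal argument: extract successively for [u 0], [u 1], and so on, then take the
    diagonal. *)
Lemma Caa_common_subseq (u : nat -> R -> C) s : (forall n, Caa (u n)) ->
  exists k : nat -> nat, {homo k : m n / (m < n)%N} /\
    forall n, exists g, aa_along (u n) (s \o k) g.
Proof.
move=> uaa.
have uK (nt : nat * (nat -> R)) : exists k : nat -> nat,
    {homo k : m n / (m < n)%N} /\ exists g, aa_along (u nt.1) (nt.2 \o k) g.
  exact: (uaa nt.1).2.
have [K KP] := choice uK.
(* [P n] composes the first [n] extractions. *)
pose fix P n : nat -> nat :=
  if n is m.+1 then P m \o K (m, s \o P m) else id.
have KI n := (KP (n, s \o P n)).1.
have PI n : {homo P n : i j / (i < j)%N}.
  by elim: n => [//|n ih] i j ij; apply: ih; exact: KI.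
have PM n j i : (n <= j)%N -> exists2 i', (i <= i')%N & P j i = P n i'.
  move=> /subnK <-; elim: (j - n)%N i => [|d ih] i; first by exists i.
  have [i' ii' e] := ih (K ((d + n)%N, s \o P (d + n)%N) i); exists i' => //.
  by apply: leq_trans ii'; apply: homo_ltn_ge; exact: KI.
exists (fun n => P n n); split.
  apply: homo_ltn ltn_trans _ => n; apply: PI.
  exact: homo_ltn_ge (KI n) n.+1.
(* [u n] converges along [s \o P n.+1], and the diagonal takes its values in the range of [P n.+1]
   from rank [n.+1] on. *)
move=> n; have [_ [g ug]] := KP (n, s \o P n); exists g.
apply: aa_along_cofinal ug => j nj; have [i ji e] := PM n.+1 j j nj.
by exists i => //=; rewrite e.
Qed.

(** A sequence of approximants within [n.+1%:R^-1] of [f] has a common extraction, along which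
    [aa_along_approx] applies to [f]. *)
Lemma Caa_unif_limit f : continuous f ->
  (forall e, 0 < e -> exists2 g, Caa g & forall x, `|f x - g x| <= e) -> Caa f.
Proof.
move=> fc fu; split=> // s.
have fn (n : nat) : exists g, Caa g /\ forall x, `|f x - g x| <= n.+1%:R^-1.
  have [|g gaa fg] := fu n.+1%:R^-1; last by exists g.
  by rewrite invr_gt0.
have [u uP] := choice fn.
have [k [kI ku]] := Caa_common_subseq s (fun n => (uP n).1).
exists k; split=> //; apply: aa_along_approx => e e0.
near \oo => n; have [q uq] := ku n; exists (u n), q; split=> // x.
apply: le_trans ((uP n).2 x) _; apply/ltW; near: n.
by have := near_infty_natSinv_lt (PosNum e0).
Unshelve. all: by end_near. Qed.

Lemma Caa_op (op : C -> C -> C) f1 f2 :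
  (forall f g, continuous f -> continuous g ->
    continuous (fun x => op (f x) (g x))) ->
  (forall g1 g2 t, aa_along f1 t g1 -> aa_along f2 t g2 ->
    exists g, aa_along (fun x => op (f1 x) (f2 x)) t g) ->
  Caa f1 -> Caa f2 -> Caa (fun x => op (f1 x) (f2 x)).
Proof.
move=> opc opaa aa1 aa2; split; first exact: opc aa1.1 aa2.1.
move=> s.
(* The sequence [f1, f2, f2, ...] gives an extraction common to both functions. *)
have [|k [kI ku]] := @Caa_common_subseq (fun n => if n is 0 then f1 else f2) s.
  by case.
exists k; split=> //; have [g1 h1] := ku 0%N; have [g2 h2] := ku 1%N.
exact: opaa h1 h2.
Qed.

Lemma continuousCM f g : continuous f -> continuous g -> continuous (f * g).
Proof.
move=> /continuousCP[fr fi] /continuousCP[gr gi].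
rewrite (_ : f * g = fun x => (f x * g x : C))// => x; apply/cvgCP.
rewrite complexReM complexImM; split.
  under eq_fun do rewrite complexReM.
  by apply: cvgB; apply: cvgM; [exact: fr|exact: gr|exact: fi|exact: gi].
under eq_fun do rewrite complexImM.
by apply: cvgD; apply: cvgM; [exact: fr|exact: gi|exact: fi|exact: gr].
Qed.

Lemma CaaD f g : Caa f -> Caa g -> Caa (f + g).
Proof.
apply: Caa_op => [f1 f2 c1 c2 x|g1 g2 t h1 h2].
  by apply: continuousD; [exact: c1|exact: c2].
by exists (g1 + g2); exact: aa_alongD.
Qed.

Lemma CaaM f g : Caa f -> Caa g -> Caa (f * g).
Proof.
apply: Caa_op => [f1 f2 c1 c2|g1 g2 t h1 h2]; first exact: continuousCM.
by exists (g1 * g2); exact: aa_alongM.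
Qed.

Lemma Caa_cst z : Caa (cst z).
Proof.
split=> [x|s]; first exact: cvg_cst.
by exists id; split=> //; exists (cst z); exact: aa_along_cst.
Qed.

(** Difference quotients of [f] with a fixed step converge along the same sequences as [f], and by
    [taylor1] they approximate [df] uniformly. *)
Lemma Caa_derive f (df ddf : R -> C) M :
  (forall x, is_derive x 1 f (df x)) -> (forall x, is_derive x 1 df (ddf x)) ->
  (forall x, `|ddf x| <= M) -> Caa f -> Caa df.
Proof.
move=> fD dfD ddfM [_ aaf]; split.
  by move=> x; apply: derivable_continuous; case: (dfD x).
move=> s; have [k [kI [g fg]]] := aaf s; exists k; split=> //.
have M0 : 0 <= M by apply: le_trans (ddfM 0); exact: normr_ge0.
(* The quotient of step [h] is within [4 * M * h] of [df], hence within [e]; adding [1] allows for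
   [M = 0]. *)
apply: aa_along_approx => e e0; pose h := e / (4 * M + 1).
have M1 : 0 < 4 * M + 1 by lra.
have h0 : 0 < h by rewrite divr_gt0.
(* The quotient is spelled with constants, sums and products to match the stability lemmas of
   [aa_along]. *)
pose D (p : R -> C) : R -> C :=
  cst (h^-1 *: 1) * ((fun x => p (x + h)) + cst (- 1) * p).
have DE p x : D p x = h^-1 *: (p (x + h) - p x).
  by rewrite /D !fctE mulN1r -scalerAl mul1r.
exists (D f), (D g); split.
  apply: aa_alongM; first exact: aa_along_cst.
  apply: aa_alongD; first exact: aa_along_shift.
  by apply: aa_alongM => //; exact: aa_along_cst.
move=> x; rewrite DE distrC.
rewrite (_ : _ - _ = h^-1 *: (f (x + h) - f x - h *: df x)); last first.
  by rewrite [RHS]scalerBr scalerA mulVf ?gt_eqF// scale1r.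
rewrite normrZ normfV (gtr0_norm h0) ler_pdivrMl//.
apply: le_trans (taylor1 fD dfD ddfM x h) _.
rewrite (gtr0_norm h0) expr2 mulrCA ler_pM2l// -[leRHS](divfK (lt0r_neq0 M1)).
by rewrite mulrC -/h ler_pM2l// lerDl.
Qed.

Lemma Baa_sub : Baa `<=` Caa `&` @DLinf R.
Proof.
move=> f [fs faa]; split; first exact: (faa 0%N).
by apply/DLinfP; split=> // i; exact: Caa_bounded.
Qed.

(** The converse inclusion is an induction on the order: the derivative of order [i.+1] inherits
    almost automorphy from that of order [i], because the one of order [i.+2] is bounded. *)
Lemma Baa_eq : Baa = Caa `&` @DLinf R.
Proof.
apply/seteqP; split; first exact: Baa_sub.
move=> f [faa /DLinfP[fs fM]]; split=> //; elim=> [//|i ih].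
have [M hM] := fM i.+2; apply: Caa_derive hM ih => x; exact: smooth_is_derive.
Qed.

End AlmostAutomorphic.

(** * Fréchet algebra structure of [DLinf] and [Baa] *)

Section FrechetAlgebra.
Variable R : realType.
Local Notation C := (Rcomplex R).
Implicit Types (x : R) (z : C) (f g : R -> C) (B : set (R -> C)).

Lemma Dnorm_mul_continuous B f g : algebra_of_functions B -> B `<=` DLinf ->
  B f -> B g ->
  (fun z : (R -> C) * (R -> C) => z.1 * z.2) @
    filter_prod (nbhs_seminorms Dnorm B f) (nbhs_seminorms Dnorm B g)
  --> nbhs_seminorms Dnorm B (f * g).
Proof.
move=> [_ BD BZ BM] BDL Bf Bg P [[m e] /= e0 meP].
have BB f1 f2 : B f1 -> B f2 -> B (f1 - f2).
  move=> b1 b2; rewrite (_ : f1 - f2 = f1 + cst (-1) * f2).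
    by apply: BD => //; exact: BZ.
  by apply/funext => y; rewrite !fctE mulN1r.
pose K : R := m.+1%:R * 2 ^+ m * (1 + Dnorm m f + Dnorm m g).
have K0 : 0 <= K.
  by rewrite mulr_ge0// ?addr_ge0 ?Dnorm_ge0// mulr_ge0// exprn_ge0.
(* With both factors moved by less than [d], the product moves by at most [K * d]: [d <= 1] absorbs
   the term [d * d], and [d <= e / (K + 1)] gives [K * d < e]. *)
pose d := Num.min 1 (e / (K + 1)).
have K1 : 0 < K + 1 by rewrite ltr_wpDl.
have d0 : 0 < d by rewrite lt_min ltr01 divr_gt0.
have d1 : d <= 1 by rewrite ge_min lexx.
have dK : K * d < e.
  apply: (@le_lt_trans _ _ (K * (e / (K + 1)))).
    by rewrite ler_wpM2l// ge_min lexx orbT.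
  by rewrite mulrCA gtr_pMr// ltr_pdivrMr// mul1r ltrDl.
exists ([set h | B h /\ Dnorm m (h - f) < d],
        [set h | B h /\ Dnorm m (h - g) < d]).
  by split; exists (m, d).
case=> f' g' /= [[Bf' ff'] [Bg' gg']]; apply: meP; split; first exact: BM.
have -> : f' * g' - f * g = (f' - f) * (g' - g) + ((f' - f) * g + f * (g' - g)).
  by rewrite mulrBl !mulrBr mulrBl; ring.
apply: le_lt_trans dK.
have DB := fun h (Bh : B h) => BDL _ Bh.
have BF := BB _ _ Bf' Bf; have BG := BB _ _ Bg' Bg.
have BFgfG := BD _ _ (BM _ _ BF Bg) (BM _ _ Bf BG).
apply: le_trans (DnormD _ (DB _ (BM _ _ BF BG)) (DB _ BFgfG)) _.
apply: (@le_trans _ _ (m.+1%:R * 2 ^+ m * (d * d) +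
    (m.+1%:R * 2 ^+ m * (d * Dnorm m g) + m.+1%:R * 2 ^+ m * (Dnorm m f * d)))).
  apply: lerD.
    apply: le_trans (DnormM _ (DB _ BF) (DB _ BG)) _.
    by rewrite ler_wpM2l ?mulr_ge0 ?exprn_ge0// ler_pM ?Dnorm_ge0// ltW.
  apply: le_trans (DnormD _ (DB _ (BM _ _ BF Bg)) (DB _ (BM _ _ Bf BG))) _.
  apply: lerD.
    apply: le_trans (DnormM _ (DB _ BF) (DB _ Bg)) _.
    by rewrite ler_wpM2l ?mulr_ge0 ?exprn_ge0// ler_wpM2r ?Dnorm_ge0// ltW.
  apply: le_trans (DnormM _ (DB _ Bf) (DB _ BG)) _.
  by rewrite ler_wpM2l ?mulr_ge0 ?exprn_ge0// ler_wpM2l ?Dnorm_ge0// ltW.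
rewrite -!mulrDr /K -[leRHS]mulrA ler_wpM2l ?mulr_ge0 ?exprn_ge0//.
have -> : (1 + Dnorm m f + Dnorm m g) * d =
  d + (d * Dnorm m g + Dnorm m f * d) by ring.
by rewrite lerD2r ger_pMr.
Qed.

(** A criterion common to [DLinf] and [Baa]. Cauchy sequences converge in [DLinf], in particular
    uniformly, and the closedness hypothesis puts the limit in [B]. *)
Lemma frechet_algebra_Dnorm B : algebra_of_functions B -> B `<=` DLinf ->
  (forall f, DLinf f ->
    (forall e, 0 < e -> exists2 g, B g & forall x, `|f x - g x| <= e) -> B f) ->
  frechet_algebra (@Dnorm R) B.
Proof.
move=> Balg BDL Bclosed; split=> //.
- move=> m; split=> [f _|f g Bf Bg|z f Bf]; first exact: Dnorm_ge0.
    by apply: DnormD; exact: BDL.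
  by apply: DnormZ; exact: BDL.
- by move=> m n f mn _; exact: Dnorm_nondecreasing.
- move=> f Bf f0; apply/funext => x; apply: normr0_eq0; apply/eqP.
  rewrite eq_le normr_ge0 andbT -(f0 0%N).
  exact: (norm_le_Dnorm x (BDL _ Bf) (leqnn 0)).
- move=> u Bu uC; have uD n := BDL _ (Bu n).
  have [f fD uf] := DLinf_complete_lim uD uC; exists f.
    apply: Bclosed => // e /(uf 0%N)[N _ hN]; exists (u N) => // x.
    have [_ dB] := smoothB (uD N).1 fD.1.
    have := norm_le_Dnorm x (DLinfB (uD N) fD) (leqnn 0).
    by rewrite dB distrC => /le_trans; apply; exact/ltW/(hN N (leqnn N)).
  move=> P [[m e] /= e0 meP]; have := uf m e e0; apply: filterS => n un.
  by apply: meP.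
- by move=> f g Bf Bg; exact: Dnorm_mul_continuous.
Qed.

Lemma DLinf_algebra : algebra_of_functions (@DLinf R).
Proof.
split; [exact: DLinf0|exact: DLinfD|exact: DLinf_cstM|exact: DLinfM].
Qed.

Lemma Baa_algebra : algebra_of_functions (@Baa R).
Proof.
rewrite Baa_eq; split.
- by split; [exact: Caa_cst|exact: DLinf0].
- by move=> f g [? ?] [? ?]; split; [exact: CaaD|exact: DLinfD].
- move=> z f [? ?]; split; last exact: DLinf_cstM.
  by apply: CaaM => //; exact: Caa_cst.
- by move=> f g [? ?] [? ?]; split; [exact: CaaM|exact: DLinfM].
Qed.

Lemma Baa_frechet_subalgebra : frechet_subalgebra (@Dnorm R) Baa DLinf.
Proof.
have BD : Baa `<=` @DLinf R by move=> f /Baa_sub[].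
split=> //; apply: frechet_algebra_Dnorm => //.
- exact: DLinf_algebra.
- exact: Baa_algebra.
(* By [Baa_eq], only [f] itself has to be shown almost automorphic, not its derivatives. *)
- move=> f fD fB; rewrite Baa_eq; split=> //; apply: Caa_unif_limit.
    exact: (smooth_continuous (i := 0) fD.1).
  by move=> e /fB[g /Baa_sub[gaa _] fg]; exists g.
Qed.

End FrechetAlgebra.

(** * Convolution with an integrable function *)

Section Convolution.
Variable R : realType.
Local Notation C := (Rcomplex R).
Local Notation Re := (@complex.Re R).
Local Notation Im := (@complex.Im R).
Local Notation mu := (@lebesgue_measure R).
Implicit Types (x : R) (z : C) (f g h F G : R -> C).

Lemma measurable_Cnorm F : Cmeasurable F ->
  measurable_fun setT (fun y => `|F y|).
Proof.
move=> [mr mi].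
rewrite (_ : (fun y => _) =
    Num.sqrt \o (fun y => Re (F y) * Re (F y) + Im (F y) * Im (F y))).
  apply: measurableT_comp.
    by apply: continuous_measurable_fun; exact: sqrt_continuous.
  by apply: measurable_funD; exact: measurable_funM.
by apply/funext => y /=; rewrite Rcomplex_normE !expr2.
Qed.

Lemma Cmeasurable_cvg (F : nat -> R -> C) G : (forall n, Cmeasurable (F n)) ->
  (forall y, F n y @[n --> \oo] --> G y) -> Cmeasurable G.
Proof.
move=> mF FG; split.
  apply: (@measurable_fun_cvg _ _ _ _ (fun n y => Re (F n y))) => [n|y _].
    exact: (mF n).1.
  by have /cvgCP[] := FG y.
apply: (@measurable_fun_cvg _ _ _ _ (fun n y => Im (F n y))) => [n|y _].
  exact: (mF n).2.
by have /cvgCP[] := FG y.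
Qed.

Lemma CmeasurableM F G : Cmeasurable F -> Cmeasurable G ->
  Cmeasurable (fun y => F y * G y).
Proof.
move=> [Fr Fi] [Gr Gi]; split.
  rewrite (_ : (fun y => _) =
    (fun y => Re (F y) * Re (G y) - Im (F y) * Im (G y))).
    by apply: measurable_funB; exact: measurable_funM.
  by apply/funext => y; rewrite complexReM.
rewrite (_ : (fun y => _) =
  (fun y => Re (F y) * Im (G y) + Im (F y) * Re (G y))).
  by apply: measurable_funD; exact: measurable_funM.
by apply/funext => y; rewrite complexImM.
Qed.

Lemma Cmeasurable_reflect x F : Cmeasurable F ->
  Cmeasurable (fun y => F (x - y)).
Proof.
move=> [Fr Fi].
have ms : measurable_fun setT (fun y : R => x - y).
  by apply: measurable_funB => //; exact: measurable_cst.
by split; [exact: (measurableT_comp Fr ms)|exact: (measurableT_comp Fi ms)].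
Qed.

Lemma Lp1P F : Lp 1 F <->
  Cmeasurable F /\ mu.-integrable setT (EFin \o (fun y => `|F y|)).
Proof.
rewrite /Lp/= /CLnorm Lnorm1; split=> -[mF iF]; split=> //.
  apply/integrableP; split; last exact: iF.
  by apply/measurable_EFinP; exact: measurable_Cnorm.
by have /integrableP[] := iF.
Qed.

Lemma Lp1_le F h (c : R) : Cmeasurable F -> Lp 1 h ->
  (forall y, `|F y| <= c * `|h y|) -> Lp 1 F.
Proof.
move=> mF /Lp1P[mh ih] Fh; apply/Lp1P; split=> //.
have ich := integrableZl measurableT c ih.
apply: le_integrable ich => //.
  by apply/measurable_EFinP; exact: measurable_Cnorm.
move=> y _ /=; rewrite lee_fin normr_id (le_trans (Fh y))//.
exact: ler_norm.
Qed.

Lemma Lp1_ReIm F : Lp 1 F ->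
  mu.-integrable setT (EFin \o (fun y => Re (F y))) /\
  mu.-integrable setT (EFin \o (fun y => Im (F y))).
Proof.
move=> /Lp1P[[mr mi] iF]; split; apply: le_integrable iF => //.
- exact/measurable_EFinP.
- by move=> y _ /=; rewrite lee_fin normr_id norm_Re_le.
- exact/measurable_EFinP.
- by move=> y _ /=; rewrite lee_fin normr_id norm_Im_le.
Qed.

Lemma CmeasurableB F G : Cmeasurable F -> Cmeasurable G ->
  Cmeasurable (fun y => F y - G y).
Proof.
move=> [Fr Fi] [Gr Gi]; split.
  rewrite (_ : (fun y => _) = (fun y => Re (F y) - Re (G y))).
    exact: measurable_funB.
  by apply/funext => y; rewrite complexReB.
rewrite (_ : (fun y => _) = (fun y => Im (F y) - Im (G y))).
  exact: measurable_funB.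
by apply/funext => y; rewrite complexImB.
Qed.

Lemma Lp1B F G : Lp 1 F -> Lp 1 G -> Lp 1 (fun y => F y - G y).
Proof.
move=> /Lp1P[mF iF] /Lp1P[mG iG]; apply/Lp1P.
have mFG := CmeasurableB mF mG; split=> //.
apply: le_integrable (integrableD measurableT iF iG) => //.
  by apply/measurable_EFinP; exact: measurable_Cnorm.
move=> y _ /=; rewrite lee_fin normr_id (le_trans (ler_normB _ _))//.
exact: ler_norm.
Qed.

Lemma Lp1Z (a : R) F : Lp 1 F -> Lp 1 (fun y => a *: F y).
Proof.
move=> LF; have [[mr mi] _] := LF; apply: (@Lp1_le _ F `|a|) => //.
  split.
    rewrite (_ : (fun y => _) = (fun y => a * Re (F y))).
      by apply: measurable_funM => //; exact: measurable_cst.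
    by apply/funext => y; rewrite complexReZ.
  rewrite (_ : (fun y => _) = (fun y => a * Im (F y))).
    by apply: measurable_funM => //; exact: measurable_cst.
  by apply/funext => y; rewrite complexImZ.
by move=> y; rewrite normrZ.
Qed.

Lemma CintegralB F G : Lp 1 F -> Lp 1 G ->
  Cintegral (fun y => F y - G y) = Cintegral F - Cintegral G.
Proof.
move=> /Lp1_ReIm[Fr Fi] /Lp1_ReIm[Gr Gi]; apply: Rcomplex_ext.
  rewrite complexReB -RintegralB//; apply: eq_Rintegral => y _.
  by rewrite complexReB.
rewrite complexImB -RintegralB//; apply: eq_Rintegral => y _.
by rewrite complexImB.
Qed.

Lemma CintegralZ (a : R) F : Lp 1 F ->
  Cintegral (fun y => a *: F y) = a *: Cintegral F.
Proof.
move=> /Lp1_ReIm[Fr Fi]; apply: Rcomplex_ext.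
  rewrite complexReZ -RintegralZl//; apply: eq_Rintegral => y _.
  by rewrite complexReZ.
rewrite complexImZ -RintegralZl//; apply: eq_Rintegral => y _.
by rewrite complexImZ.
Qed.

(** The factor [2] comes from bounding the integrals of the two parts separately. *)
Lemma norm_Cintegral_le F h (c : R) : Cmeasurable F -> Lp 1 h ->
  (forall y, `|F y| <= c * `|h y|) ->
  `|Cintegral F| <= 2 * (c * \int[mu]_y `|h y|).
Proof.
move=> mF Lh Fh; have [mh ih] := (Lp1P h).1 Lh.
have [Fr Fi] := Lp1_ReIm (Lp1_le mF Lh Fh).
have ich := integrableZl measurableT c ih.
have key (v : R -> R) : mu.-integrable setT (EFin \o v) ->
    (forall y, `|v y| <= `|F y|) -> `|\int[mu]_y v y| <= c * \int[mu]_y `|h y|.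
  move=> iv vF; apply: le_trans (le_normr_Rintegral _ iv) _ => //.
  rewrite -RintegralZl//; apply: le_Rintegral => //.
    exact: (integrable_abse iv).
  by move=> y _; exact: le_trans (vF y) (Fh y).
apply: le_trans (norm_le_ReIm _) _; rewrite mulr_natl mulr2n /=.
by apply: lerD; apply: key => // y; [exact: norm_Re_le|exact: norm_Im_le].
Qed.

Lemma Cintegral_dominated_cvg (F : nat -> R -> C) G h (c : R) :
  (forall n, Cmeasurable (F n)) -> Lp 1 h ->
  (forall n y, `|F n y| <= c * `|h y|) ->
  (forall y, F n y @[n --> \oo] --> G y) ->
  Cintegral (F n) @[n --> \oo] --> Cintegral G.
Proof.
move=> mF Lh Fh FG; have [mh ih] := (Lp1P h).1 Lh.
have ich := integrableZl measurableT c ih.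
have key (v : nat -> R -> R) (w : R -> R) :
    (forall n, measurable_fun setT (v n)) ->
    (forall n y, `|v n y| <= `|F n y|) ->
    (forall y, v n y @[n --> \oo] --> w y) ->
    \int[mu]_y v n y @[n --> \oo] --> \int[mu]_y w y.
  move=> mv vF vw.
  have mw : measurable_fun setT w.
    by apply: (measurable_fun_cvg mv) => y _; exact: vw.
  have vwE y : (v n y)%:E @[n --> \oo] --> (w y)%:E.
    by apply: cvg_EFin; [apply: nearW => n|exact: vw].
  have [||||iw _ lim_int] := @dominated_convergence _ _ _ mu setT measurableT
      (fun n => EFin \o v n) (EFin \o w) _ _ _ _ ich.
  - by move=> n; apply/measurable_EFinP; exact: mv.
  - by apply/measurable_EFinP; exact: mw.
  - by apply: aeW => y _; exact: vwE.
  - by apply: aeW => y n _ /=; rewrite lee_fin (le_trans (vF n y)).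
  apply: fine_cvg; rewrite fineK; last exact: integrable_fin_num.
  exact: lim_int.
apply/cvgCP; split; apply: key.
- by move=> n; exact: (mF n).1.
- by move=> n y; exact: norm_Re_le.
- by move=> y; have /cvgCP[] := FG y.
- by move=> n; exact: (mF n).2.
- by move=> n y; exact: norm_Im_le.
- by move=> y; have /cvgCP[] := FG y.
Qed.

Lemma Lp1_convolution f h M x : Cmeasurable f -> (forall y, `|f y| <= M) ->
  Lp 1 h -> Lp 1 (fun y => f (x - y) * h y).
Proof.
move=> mf fM Lh; apply: (@Lp1_le _ h M) => //.
  by apply: CmeasurableM; [exact: Cmeasurable_reflect|case: Lh].
by move=> y; rewrite Rcomplex_normrM ler_wpM2r.
Qed.

(** The remainder of the convolution is the integral against [h] of Taylor's remainders of [f] at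
    the points [x - y], so it is quadratic in the increment [t]. *)
Lemma convolution_derive f (df ddf : R -> C) h M0 M1 M2 :
  (forall x, is_derive x 1 f (df x)) -> (forall x, is_derive x 1 df (ddf x)) ->
  (forall x, `|f x| <= M0) -> (forall x, `|df x| <= M1) ->
  (forall x, `|ddf x| <= M2) -> Lp 1 h ->
  forall x, is_derive x 1 (convolution f h) (convolution df h x).
Proof.
move=> fD dfD fM dfM ddfM Lh x.
have mf : Cmeasurable f.
  apply: continuous_Cmeasurable => y; apply: derivable_continuous.
  by case: (fD y).
have mdf : Cmeasurable df.
  apply: continuous_Cmeasurable => y; apply: derivable_continuous.
  by case: (dfD y).
have Lf y := Lp1_convolution y mf fM Lh.
have Ldf y := Lp1_convolution y mdf dfM Lh.
(* [4 * M2] comes from [taylor1], the outer [2] from [norm_Cintegral_le]. *)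
apply: (@quadratic_is_derive _ _ _ _ (2 * (4 * M2 * \int[mu]_y `|h y|))) => t.
pose I0 y : C := f (x + t - y) * h y.
pose I1 y : C := f (x - y) * h y.
pose I2 y : C := df (x - y) * h y.
have L0 : Lp 1 I0 := Lf _; have L1 : Lp 1 I1 := Lf _.
have L2 := Lp1Z t (Ldf x : Lp 1 I2).
have -> : convolution f h (x + t) - convolution f h x -
    t *: convolution df h x = Cintegral (fun y => I0 y - I1 y - t *: I2 y).
  rewrite (CintegralB (Lp1B L0 L1) L2) (CintegralB L0 L1).
  by rewrite (CintegralZ t (Ldf x)).
apply: (@le_trans _ _ (2 * (4 * M2 * `|t| ^+ 2 * \int[mu]_y `|h y|))).
  apply: norm_Cintegral_le => [|//|y].
    by apply: CmeasurableB; [exact: (Lp1B L0 L1).1|exact: L2.1].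
  rewrite /I0 /I1 /I2 scalerAl -!mulrBl Rcomplex_normrM ler_wpM2r//.
  by rewrite [x + t - y]addrAC; exact: taylor1.
by rewrite le_eqVlt; apply/orP; left; apply/eqP; ring.
Qed.

(** Dominated convergence with majorant [M * |h|]. As a pointwise limit of translates of [f], [g] is
    measurable and bounded by [M], which gives the second limit in the same way as the first. *)
Lemma aa_along_convolution f g h t M : Cmeasurable f ->
  (forall y, `|f y| <= M) -> Lp 1 h ->
  aa_along f t g -> aa_along (convolution f h) t (convolution g h).
Proof.
move=> mf fM Lh [fg gf].
have gM x : `|g x| <= M by apply: (cvg_norm_le (fg x)); exact: nearW.
have mg : Cmeasurable g.
  apply: Cmeasurable_cvg fg => n.
  (* A translation is the composite of two reflections. *)
  have := Cmeasurable_reflect (- t n) (Cmeasurable_reflect 0 mf).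
  rewrite (_ : (fun y => _) = (fun y => f (y + t n)))//.
  by apply/funext => y; congr f; ring.
have mh : Cmeasurable h by case: Lh.
have lim (p q : R -> C) (r : nat -> R) x : Cmeasurable p ->
    (forall y, `|p y| <= M) ->
    (forall y, p (y + r n) @[n --> \oo] --> q y) ->
    convolution p h (x + r n) @[n --> \oo] --> convolution q h x.
  move=> mp pM pq; apply: (@Cintegral_dominated_cvg _ _ h M) => // [n|n y|y].
  - by apply: CmeasurableM => //; exact: Cmeasurable_reflect.
  - by rewrite Rcomplex_normrM ler_wpM2r.
  - apply: cvgCM; last exact: cvg_cst.
    by under eq_fun do rewrite addrAC; exact: pq.
split=> x; first exact: lim.
exact: (lim g f (fun n => - t n)).
Qed.

(** Every derivative of [f] is bounded, so the convolutions of these derivatives with [h] form a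
    family to which [derive1n_family] applies; each is almost automorphic by
    [aa_along_convolution]. *)
Lemma Baa_convolution f h : Baa f -> Lp 1 h -> Baa (convolution f h).
Proof.
move=> [fs faa] Lh.
have fM i := Caa_bounded (faa i).
pose F i := convolution (derive1n i f) h.
have FD i x : is_derive x 1 (F i) (F i.+1 x).
  have [M0 h0] := fM i; have [M1 h1] := fM i.+1; have [M2 h2] := fM i.+2.
  exact: (convolution_derive (fun y => smooth_is_derive i y fs)
    (fun y => smooth_is_derive i.+1 y fs) h0 h1 h2 Lh).
have [Fs FE] := derive1n_family FD; split=> // i; rewrite FE; split.
  by move=> x; apply: derivable_continuous; case: (FD i x).
move=> s; have [_ /(_ s)[k [kI [g fg]]]] := faa i; exists k; split=> //.
have [M hM] := fM i; exists (convolution g h).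
apply: aa_along_convolution hM Lh fg; apply: continuous_Cmeasurable.
exact: smooth_continuous.
Qed.

End Convolution.

Theorem proposition5 (R : realType) :
  [/\ Baa = Caa `&` DLinf :> set (R -> Rcomplex R),
      frechet_subalgebra (@Dnorm R) Baa DLinf &
      forall f h : R -> Rcomplex R, Baa f -> Lp 1%E h ->
        convolution_defined f h /\ Baa (convolution f h)].
Proof.
split; [exact: Baa_eq | exact: Baa_frechet_subalgebra |].
move=> f h fB Lh; split; last exact: Baa_convolution.
have [M fM] := Caa_bounded (fB.2 0%N).
move=> x; apply: (Lp1_convolution x _ fM Lh).
by apply: continuous_Cmeasurable; case: (fB.2 0%N).
Qed.
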